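(* Let $G$ be a finite simple graph with vertex set $V(G)=\{t_1,\ldots,t_s\}$, let $S=K[t_1,\ldots,t_s]$ be a polynomial ring over a field $K$, and let $I(G)\subset S$ be the edge ideal of $G$. If $I(G)^{(2)}$ is Cohen--Macaulay, then $G$ is edge-critical.
   Context: The edge ideal $I(G)$ is the ideal of $S$ generated by all $t_it_j$ with $\{t_i,t_j\}\in E(G)$. For a squarefree monomial ideal $I$ with associated primes $\mathfrak{p}_1,\ldots,\mathfrak{p}_r$ (of $S/I$), the $n$-th symbolic power is $I^{(n)}=\bigcap_{i=1}^r\mathfrak{p}_i^n$. A graded ideal $J\subset S$ is called Cohen--Macaulay if $S/J$ is a Cohen--Macaulay ring. The independence number $\beta_0(G)$ is the largest cardinality of a stable set (a set of pairwise non-adjacent vertices). An edge $e$ of $G$ is critical if $\beta_0(G\setminus e)>\beta_0(G)$, where $G\setminus e$ is obtained from $G$ by removing the edge $e$ and keeping all vertices. $G$ is edge-critical if all its edges are critical. *)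

(* Defs.v *)
From HB Require Import structures.
From mathcomp Require Import all_boot all_order all_algebra.
From mathcomp Require Import generic_quotient ring_quotient boolp mpoly.
From mathcomp Require Import ring.

Set Implicit Arguments.
Unset Strict Implicit.
Unset Printing Implicit Defensive.

Import GRing.Theory.
Local Open Scope ring_scope.
Local Open Scope quotient_scope.

(* A simple graph is a symmetric irreflexive relation on its vertices. *)
Section Graphs.
Variables (T : finType) (e : rel T).

Definition stable (A : {set T}) : bool :=
  [forall x in A, forall y in A, ~~ e x y].

Definition independence_number : nat := \max_(A : {set T} | stable A) #|A|.

Definition del_edge (a b : T) : rel T :=
  [rel x y | e x y && ([set x; y] != [set a; b])].

End Graphs.

Definition critical (T : finType) (e : rel T) (a b : T) : Prop :=
  (independence_number e < independence_number (del_edge e a b))%N.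

Definition edge_critical (T : finType) (e : rel T) : Prop :=
  forall a b, e a b -> critical e a b.

Section Ideals.
Variable R : comNzRingType.
Implicit Types (G I : {pred R}) (p : prime_idealr R).

Definition ideal_gen G : {pred R} :=
  [pred x | `[< exists2 s : seq (R * R),
      {in s, forall cg, cg.2 \in G} & x = \sum_(cg <- s) cg.1 * cg.2 >]].

Definition ideal_exp I (n : nat) : {pred R} :=
  ideal_gen [pred x | `[< exists2 s : n.-tuple R,
      {in s, forall y, y \in I} & x = \prod_(y <- s) y >]].

(* p is associated to R/I: it is the annihilator of the class of some f. *)
Definition associated_prime I p : Prop :=
  exists f : R, forall a : R, (a \in p) = (a * f \in I).

(* The symbolic power of an ideal without embedded primes, e.g. of a
   squarefree monomial ideal: all associated primes are used. *)
Definition symbolic_power I (n : nat) : {pred R} :=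
  [pred x | `[< forall p, associated_prime I p -> x \in ideal_exp p n >]].

End Ideals.

Module Localization.
Section Localization.
Variables (R : comNzRingType) (P : prime_idealr R).
Local Notation I := (P : pred R).

Definition frac : Type := {x : R * R | x.2 \notin I}.
#[export]
HB.instance Definition _ := Choice.on frac.

Definition num (x : frac) : R := (val x).1.
Definition den (x : frac) : R := (val x).2.

Lemma denP x : den x \notin I. Proof. exact: valP x. Qed.

Lemma notinM u v : u \notin I -> v \notin I -> u * v \notin I.
Proof. by move=> uP vP; rewrite prime_idealrM negb_or uP. Qed.

Lemma notin1 : 1 \notin I. Proof. by rewrite idealr1. Qed.

Definition mk (a : R) (u : R) (uP : u \notin I) : frac :=
  exist (fun x : R * R => x.2 \notin I) (a, u) uP.

Lemma numE a u uP : num (@mk a u uP) = a. Proof. by []. Qed.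
Lemma denE a u uP : den (@mk a u uP) = u. Proof. by []. Qed.

Definition equiv (x y : frac) : bool :=
  `[< exists2 w, w \notin I & w * (num x * den y) = w * (num y * den x) >].

Lemma equivP x y :
  reflect (exists2 w, w \notin I & w * (num x * den y) = w * (num y * den x))
          (equiv x y).
Proof. exact: asboolP. Qed.

Lemma equiv_is_equiv : equiv_class_of equiv.
Proof.
split=> [x|x y|y x z].
- by apply/equivP; exists 1; rewrite ?notin1.
- by apply/equivP/equivP => -[w wP E]; exists w.
- move=> /equivP[v vP Ev] /equivP[w wP Ew]; apply/equivP.
  exists (v * w * den y); first by rewrite !notinM ?denP.
  transitivity (w * den z * (v * (num x * den y))); first by ring.
  rewrite Ev.
  transitivity (v * den x * (w * (num y * den z))); first by ring.
  by rewrite Ew; ring.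
Qed.

Canonical equiv_equiv := EquivRelPack equiv_is_equiv.
Canonical equiv_encModRel := defaultEncModRel equiv.

Definition loc := {eq_quot equiv}.

#[export]
HB.instance Definition _ : EqQuotient frac equiv loc := EqQuotient.on loc.
#[export]
HB.instance Definition _ := Choice.on loc.

Lemma eq_locP x y :
  reflect (exists2 w, w \notin I & w * (num x * den y) = w * (num y * den x))
          (x == y %[mod loc]).
Proof. by rewrite piE; apply: equivP. Qed.

Definition zerof : frac := mk 0 notin1.
Definition onef : frac := mk 1 notin1.
Definition addf (x y : frac) : frac :=
  mk (num x * den y + num y * den x) (notinM (denP x) (denP y)).
Definition oppf (x : frac) : frac := mk (- num x) (denP x).
Definition mulf (x y : frac) : frac :=
  mk (num x * num y) (notinM (denP x) (denP y)).

Definition zero : loc := lift_cst loc zerof.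
Definition one : loc := lift_cst loc onef.
Definition add := lift_op2 loc addf.
Definition opp := lift_op1 loc oppf.
Definition mul := lift_op2 loc mulf.

Canonical pi_zero_morph := PiConst zero.
Canonical pi_one_morph := PiConst one.

Lemma pi_opp : {morph \pi : x / oppf x >-> opp x}.
Proof.
move=> x; unlock opp; apply/eqP/eq_locP.
case/eqP/eq_locP: (esym (reprK (\pi_loc x))) => w wP E; exists w => //.
by rewrite !numE !denE !mulNr !mulrN E.
Qed.
Canonical pi_opp_morph := PiMorph1 pi_opp.

Lemma pi_add : {morph \pi : x y / addf x y >-> add x y}.
Proof.
move=> x y; unlock add; apply/eqP/eq_locP.
case/eqP/eq_locP: (esym (reprK (\pi_loc x))) => v vP Ev.
case/eqP/eq_locP: (esym (reprK (\pi_loc y))) => w wP Ew.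
exists (v * w); first exact: notinM.
move: (repr _) (repr _) Ev Ew => y' x' Ev Ew.
rewrite !numE !denE.
transitivity (w * den y * den y' * (v * (num x * den x'))
            + v * den x * den x' * (w * (num y * den y'))); first by ring.
by rewrite Ev Ew; ring.
Qed.
Canonical pi_add_morph := PiMorph2 pi_add.

Lemma pi_mul : {morph \pi : x y / mulf x y >-> mul x y}.
Proof.
move=> x y; unlock mul; apply/eqP/eq_locP.
case/eqP/eq_locP: (esym (reprK (\pi_loc x))) => v vP Ev.
case/eqP/eq_locP: (esym (reprK (\pi_loc y))) => w wP Ew.
exists (v * w); first exact: notinM.
move: (repr _) (repr _) Ev Ew => y' x' Ev Ew.
rewrite !numE !denE.
transitivity ((v * (num x * den x')) * (w * (num y * den y'))); first by ring.
by rewrite Ev Ew; ring.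
Qed.
Canonical pi_mul_morph := PiMorph2 pi_mul.

Lemma eq_loc x y : num x * den y = num y * den x -> \pi_loc x = \pi_loc y.
Proof. by move=> E; apply/eqP/eq_locP; exists 1; rewrite ?notin1 ?E. Qed.

Lemma addA : associative add.
Proof.
move=> x y z; rewrite -[x]reprK -[y]reprK -[z]reprK !piE.
by apply: eq_loc; rewrite ?numE ?denE; ring.
Qed.

Lemma addC : commutative add.
Proof.
move=> x y; rewrite -[x]reprK -[y]reprK !piE.
by apply: eq_loc; rewrite ?numE ?denE; ring.
Qed.

Lemma add0 : left_id zero add.
Proof.
move=> x; rewrite -[x]reprK !piE.
by apply: eq_loc; rewrite ?numE ?denE; ring.
Qed.

Lemma addN : left_inverse zero opp add.
Proof.
move=> x; rewrite -[x]reprK !piE.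
by apply: eq_loc; rewrite ?numE ?denE; ring.
Qed.

#[export]
HB.instance Definition _ := GRing.isZmodule.Build loc addA addC add0 addN.
#[export]
HB.instance Definition _ :=
  @isZmodQuotient.Build frac equiv zerof oppf addf loc (lock _) pi_opp pi_add.

Lemma mulA : associative mul.
Proof.
move=> x y z; rewrite -[x]reprK -[y]reprK -[z]reprK !piE.
by apply: eq_loc; rewrite ?numE ?denE; ring.
Qed.

Lemma mulC : commutative mul.
Proof.
move=> x y; rewrite -[x]reprK -[y]reprK !piE.
by apply: eq_loc; rewrite ?numE ?denE; ring.
Qed.

Lemma mul1 : left_id one mul.
Proof.
move=> x; rewrite -[x]reprK !piE.
by apply: eq_loc; rewrite ?numE ?denE; ring.
Qed.

Lemma mulDl : left_distributive mul add.
Proof.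
move=> x y z; rewrite -[x]reprK -[y]reprK -[z]reprK !piE.
by apply: eq_loc; rewrite ?numE ?denE; ring.
Qed.

Lemma one_neq0 : one != zero.
Proof.
rewrite !piE; apply/equivP => -[w wP]; rewrite /num /den /=.
by rewrite mul0r mulr0 !mulr1 => w0; rewrite w0 idealr0 in wP.
Qed.

#[export]
HB.instance Definition _ := GRing.Zmodule_isComNzRing.Build loc
  mulA mulC mul1 mulDl one_neq0.
#[export]
HB.instance Definition _ :=
  @isNzRingQuotient.Build frac equiv zerof oppf addf onef mulf loc
    (lock _) pi_mul.

End Localization.
Module Exports.
HB.reexport.
End Exports.
End Localization.
Export Localization.Exports.

Notation localization := Localization.loc.

Section CohenMacaulay.
Variable R : comNzRingType.

(* The unit ideal, which [idealr] excludes, is generated by 1. *)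
Definition noetherian : Prop :=
  forall I : idealr R, exists s : seq R, I =i ideal_gen [pred y in s].

Definition prime_chain (n : nat) (p : nat -> prime_idealr R) : Prop :=
  forall i, (i < n)%N ->
    {subset p i <= p i.+1} /\ exists2 x, x \in p i.+1 & x \notin p i.

Definition krull_dim (d : nat) : Prop :=
  (exists p, prime_chain d p) /\ forall n p, prime_chain n p -> (n <= d)%N.

Definition regular_seq (s : seq R) : Prop :=
  1 \notin ideal_gen [pred y in s] /\
  forall i, (i < size s)%N -> forall a : R,
    a * s`_i \in ideal_gen [pred y in take i s] ->
    a \in ideal_gen [pred y in take i s].

(* In a local ring, the elements of the maximal ideal are the nonunits. *)
Definition nonunit (x : R) : Prop := ~ exists y : R, x * y = 1.

Definition regular_seq_in_max (s : seq R) : Prop :=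
  regular_seq s /\ {in s, forall x, nonunit x}.

Definition local_depth (d : nat) : Prop :=
  (exists2 s, regular_seq_in_max s & size s = d) /\
  forall s, regular_seq_in_max s -> (size s <= d)%N.

Definition local_cohen_macaulay : Prop :=
  exists2 d, local_depth d & krull_dim d.

End CohenMacaulay.

(* Localizing at all primes is equivalent to localizing at the maximal ideals. *)
Definition cohen_macaulay (R : comNzRingType) : Prop :=
  noetherian R /\
  forall p : prime_idealr R, local_cohen_macaulay (localization p).

(* [idealr] is the structure of proper ideals over which the quotient ring is
   defined; J itself is only given as a predicate. *)
Definition cohen_macaulay_ideal (R : comNzRingType) (J : {pred R}) : Prop :=
  exists2 I : idealr R, I =i J & cohen_macaulay {ideal_quot I}.

Definition edge_ideal (K : fieldType) (s : nat) (e : rel 'I_s) :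
    {pred {mpoly K[s]}} :=
  ideal_gen [pred m : {mpoly K[s]} |
    [exists i, exists j, e i j && (m == 'X_i * 'X_j)]].
Arguments edge_ideal K {s} e.

(* Main.v *)
(* Fix an edge {i,j}, put J = I(G)^(2) and, for a set C of vertices, let P_C be
   the prime ideal generated by the variables of C.  The heart of the matter is
   a connectedness theorem in the style of Hartshorne: if the maximal stable
   sets containing i or j are split into two nonempty families AA and BB, then
   some F in AA and F' in BB satisfy |F| = |F'| = |F cap F'| + 1.

   Choose F, F' with D = F cap F' as large as possible, and localize S/J at
   P_(~D).  If |F \ D| >= 2, this local ring has dimension, hence depth, at
   least 2; let f1, f2 be a regular sequence.  Let A (resp. B) be the
   intersection of the P_(~G) for G in AA (resp. BB).  The choice of D implies
   that A + B is locally the maximal ideal, so that fk = ak + bk up to a unit;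
   moreover w A B is contained in J for w = t_i t_j.  Hence (w a1) f2 = (w a2) f1,
   so w a1 = c f1 for some c, which gives (w - c) A = 0 and c B = 0.  Since
   J is contained in the primary ideals P_(~F)^2 and P_(~F')^2, it follows that
   w is locally in P_(~F)^2 + P_(~F')^2.  This is impossible, because w has
   degree 1 in the variables outside F, and also in those outside F'.

   Splitting by cardinality shows that all these stable sets have the same size,
   and then that this size is the independence number.  Splitting into the sets
   that contain i and those that contain j gives F = D + i and F' = D + j, and
   D + i + j is stable in G \ {i,j}. *)
Require Import Defs.
From HB Require Import structures.
From mathcomp Require Import all_boot all_algebra mpoly.
From mathcomp Require Import generic_quotient ring_quotient boolp ring.

Set Implicit Arguments.
Unset Strict Implicit.
Unset Printing Implicit Defensive.

Import GRing.Theory.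
Local Open Scope ring_scope.
Local Open Scope quotient_scope.

(** * The grading by degree in a set of variables; monomial primes and their squares *)

Section VariableIdeals.
Variables (K : fieldType) (s : nat).
Local Notation S := {mpoly K[s]}.
Implicit Types (C : {set 'I_s}) (f g : S) (m : 'X_{1..s}).

Definition deg_in C m : nat := \sum_(k in C) m k.

Lemma deg_in1 C k : deg_in C U_(k)%MM = (k \in C).
Proof.
rewrite /deg_in big_mkcond /= (bigD1 k) //= mnm1E eqxx big1; first by case: ifP.
by move=> i ik; rewrite mnm1E eq_sym (negPf ik) if_same.
Qed.

Lemma deg_inD C m1 m2 : deg_in C (m1 + m2)%MM = (deg_in C m1 + deg_in C m2)%N.
Proof. by rewrite -big_split; apply: eq_bigr => k _; rewrite mnmDE. Qed.

Lemma deg_inS C C' m : C \subset C' -> (deg_in C m <= deg_in C' m)%N.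
Proof.
move=> CC'; rewrite /deg_in [X in (_ <= X)%N](big_setID C) /= (setIidPr CC').
exact: leq_addr.
Qed.

(** The substitution sending ['X_k] to ['X_k] times the new variable for [k] in [C]: the coefficient
    of degree [d] of the image is the component of degree [d] in the variables of [C]. *)
Definition grade_in_mmap C : S -> {poly S} :=
  mmap (polyC \o @mpolyC s K) (fun k : 'I_s => ('X_k : S)%:P * 'X^(k \in C)).
HB.instance Definition _ C := GRing.RMorphism.on (grade_in_mmap C).
(* Locked to prevent the unification from unfolding [mmap]. *)
Definition grade_in C : {rmorphism S -> {poly S}} :=
  locked (grade_in_mmap C : {rmorphism S -> {poly S}}).

Lemma grade_inC C (c : K) : grade_in C c%:MP = c%:MP%:P.
Proof. by rewrite /grade_in; unlock; rewrite /= /grade_in_mmap mmapC. Qed.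

Lemma grade_inX C m : grade_in C 'X_[m] = 'X_[m]%:P * 'X^(deg_in C m).
Proof.
rewrite /grade_in; unlock.
rewrite /= /grade_in_mmap mmapX /mmap1 mpolyXE_id rmorph_prod /= /deg_in -prodrXr.
rewrite [X in _ = _ * X]big_mkcond -big_split /=; apply: eq_bigr => k _.
by rewrite exprMn rmorphXn /= -exprM; case: (k \in C); rewrite ?mul1n.
Qed.

Lemma mcoeff_grade_in C f d m :
  ((grade_in C f)`_d)@_m = f@_m *+ (deg_in C m == d).
Proof.
rewrite {1 2}[f]mpolyE rmorph_sum /= coef_sum !raddf_sum /= -sumrMnl.
apply: eq_bigr => m' _; rewrite -mul_mpolyC rmorphM grade_inC grade_inX.
rewrite mulrA -rmorphM /= coefMXn coefC mul_mpolyC.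
rewrite !mcoeffZ !mcoeffX.
have [->|] := eqVneq m' m; last first.
  by rewrite mulr0 mul0rn; case: ifP; rewrite ?mcoeff0 //;
    case: ifP; rewrite ?mcoeff0 // mcoeffZ mcoeffX => _ _ /negPf->; rewrite mulr0.
rewrite subn_eq0; case: ltngtP; rewrite ?mcoeff0 ?mulr0n ?mulr1n //.
by rewrite mcoeffZ mcoeffX eqxx.
Qed.

(* The ideal generated by the variables in C and its square, as the sets of the
   polynomials whose components of degree 0, resp. 0 and 1, in C vanish. *)
Definition var_ideal C : {pred S} := [pred f | (grade_in C f)`_0 == 0].
Definition var_ideal2 C : {pred S} :=
  [pred f | ((grade_in C f)`_0 == 0) && ((grade_in C f)`_1 == 0)].

Lemma var_idealP C f :
  reflect (forall m, deg_in C m = 0%N -> f@_m = 0) (f \in var_ideal C).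
Proof.
apply: (iffP eqP) => [f0 m m0|f0].
  by have := congr1 (mcoeff m) f0; rewrite mcoeff_grade_in m0 eqxx mcoeff0.
apply/mpolyP => m; rewrite mcoeff_grade_in mcoeff0.
by case: eqP => // /f0->.
Qed.

Lemma mcoeff_var_ideal2 C f m :
  f \in var_ideal2 C -> deg_in C m = 1%N -> f@_m = 0.
Proof.
move=> /andP[_ /eqP f1] m1.
by have := congr1 (mcoeff m) f1; rewrite mcoeff_grade_in m1 eqxx mcoeff0.
Qed.

Lemma var_ideal_closed C : idealr_closed (var_ideal C).
Proof.
split=> [||a u v /eqP u0 /eqP v0]; rewrite inE.
- by rewrite rmorph0 coef0.
- by rewrite rmorph1 coef1 oner_eq0.
- by rewrite rmorphD rmorphM coefD coef0M u0 v0 mulr0 addr0.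
Qed.
HB.instance Definition _ C := isIdealr.Build S (var_ideal C) (var_ideal_closed C).

Lemma var_ideal_prime C : prime_idealr_closed (var_ideal C).
Proof. by move=> u v; rewrite !inE rmorphM coef0M mulf_eq0. Qed.
HB.instance Definition _ C :=
  isPrimeIdealrClosed.Build S (var_ideal C) (@var_ideal_prime C).

Lemma var_ideal2M C f g :
  f \in var_ideal C -> g \in var_ideal C -> f * g \in var_ideal2 C.
Proof.
move=> /eqP f0 /eqP g0; rewrite inE rmorphM coef0M f0 mul0r eqxx coefM.
by rewrite !big_ord_recr big_ord0 /= f0 g0 mul0r mulr0 !addr0 eqxx.
Qed.

Lemma var_ideal2_closed C : zmod_closed (var_ideal2 C).
Proof.
split=> [|u v /andP[/eqP u0 /eqP u1] /andP[/eqP v0 /eqP v1]]; rewrite inE.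
  by rewrite rmorph0 !coef0 eqxx.
by rewrite rmorphB !coefB u0 u1 v0 v1 subr0 eqxx.
Qed.
HB.instance Definition _ C :=
  GRing.isZmodClosed.Build S (var_ideal2 C) (var_ideal2_closed C).

Lemma var_ideal2_Mr C f g : f \in var_ideal2 C -> g * f \in var_ideal2 C.
Proof.
move=> /andP[/eqP f0 /eqP f1]; rewrite inE rmorphM coef0M f0 mulr0 eqxx coefM.
by rewrite !big_ord_recr big_ord0 /= f0 f1 !mulr0 !addr0 eqxx.
Qed.

(** If [f0], [f1], [g0] are the components of degrees 0 and 1, the product has components [g0 * f0]
    and, once [f0 = 0], [g0 * f1]; both can be cancelled in a domain. *)
Lemma var_ideal2_primary C f g :
  g \notin var_ideal C -> g * f \in var_ideal2 C -> f \in var_ideal2 C.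
Proof.
rewrite !inE => /negPf g0; rewrite rmorphM coef0M mulf_eq0 g0 => /andP[/eqP f0].
rewrite coefM !big_ord_recr big_ord0 /= f0 mulr0 eqxx addr0 add0r.
by rewrite mulf_eq0 g0.
Qed.

Lemma var_ideal_exp2 C : {subset ideal_exp (var_ideal C) 2 <= var_ideal2 C}.
Proof.
move=> f /asboolP[t tP ->]; rewrite big_seq; apply: rpred_sum => -[c g] /tP.
move=> /asboolP[y yP ->] /=; apply: var_ideal2_Mr.
rewrite big_tuple !big_ord_recl big_ord0 mulr1.
by apply: var_ideal2M; apply: yP; apply: mem_tnth.
Qed.

Lemma mem_var_ideal C k : ('X_k \in var_ideal C) = (k \in C).
Proof.
rewrite inE grade_inX deg_in1.
case: (k \in C); rewrite coefMXn ?eqxx //= coefC eqxx; apply/eqP.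
move=> /(congr1 (mcoeff U_(k))) /eqP.
by rewrite mcoeffX eqxx mcoeff0 oner_eq0.
Qed.

Lemma var_idealS C C' : C \subset C' -> {subset var_ideal C <= var_ideal C'}.
Proof.
move=> CC' f /var_idealP fC; apply/var_idealP => m m0; apply: fC; apply/eqP.
by rewrite -leqn0 -m0 deg_inS.
Qed.

End VariableIdeals.

Arguments var_ideal K {s} C.
Arguments var_ideal2 K {s} C.

(** * Localized quotient rings: primes, dimension and depth *)

Section Localizations.

Lemma prime_idealr_of_closed (R : comNzRingType) (P : {pred R}) :
  idealr_closed P -> prime_idealr_closed P ->
  exists Q : prime_idealr R, Q =i P.
Proof.
move=> hI hP; pose a := isIdealr.Build R P hI.
pose b := isPrimeIdealrClosed.Build R P hP.
pose Q : prime_idealr R := HB.pack (P : R -> bool) a b.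
by exists Q.
Qed.

(** Testing a representative is sound, since two representatives of a class differ by an element of
    [I], hence of [P]. *)
Lemma quotient_prime (R : comNzRingType) (I : idealr R) (P : prime_idealr R) :
  {subset I <= P} ->
  exists Q : prime_idealr {ideal_quot I},
    forall x, (\pi_{ideal_quot I} x \in Q) = (x \in P).
Proof.
move=> IP; pose Q : {pred {ideal_quot I}} := [pred x | repr x \in P].
have QE x : (\pi_{ideal_quot I} x \in Q) = (x \in P).
  rewrite inE; case: piP => y /eqP; rewrite -Quotient.idealrBE => /IP xyP.
  by apply/idP/idP => ?; [rewrite -[x](subrK y) rpredD|
     rewrite -[y](subKr x) rpredB].
have [|u v|Q' Q'E] := @prime_idealr_of_closed _ Q; last first.
- by exists Q' => x; rewrite Q'E QE.
- by rewrite -[u]reprK -[v]reprK -rmorphM !QE prime_idealrM.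
split=> [||a u v].
- by rewrite -(rmorph0 \pi_{ideal_quot I}) QE rpred0.
- by rewrite -(rmorph1 \pi_{ideal_quot I}) QE idealr1.
- rewrite -[a]reprK -[u]reprK -[v]reprK -rmorphM -rmorphD !QE => uP vP.
  by rewrite rpredD ?idealMr.
Qed.

(* [theta] is, up to isomorphism, the map from S to the localization of S / I
   at the image of P. *)
Record is_localization (S T : comNzRingType) (I P : {pred S})
    (theta : {rmorphism S -> T}) : Prop := IsLocalization {
  loc_unit : forall u, u \notin P -> exists v, theta u * v = 1;
  loc_frac : forall x, exists u n, u \notin P /\ x * theta u = theta n;
  loc_ker : forall g, theta g = 0 <-> exists2 u, u \notin P & u * g \in I
}.

Section Fraction.
Variables (R : comNzRingType) (P : prime_idealr R).
Definition to_loc (x : R) : localization P :=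
  \pi_(localization P) (Localization.mk x (Localization.notin1 P)).

Lemma to_loc_zmod_morphism : zmod_morphism to_loc.
Proof.
move=> x y; rewrite /to_loc !piE; apply: Localization.eq_loc.
by rewrite !Localization.numE !Localization.denE; ring.
Qed.
HB.instance Definition _ :=
  GRing.isZmodMorphism.Build R (localization P) to_loc to_loc_zmod_morphism.

Lemma to_loc_monoid_morphism : monoid_morphism to_loc.
Proof.
split=> [|x y]; rewrite /to_loc !piE; apply: Localization.eq_loc => //.
by rewrite !Localization.numE !Localization.denE; ring.
Qed.
HB.instance Definition _ :=
  GRing.isMonoidMorphism.Build R (localization P) to_loc to_loc_monoid_morphism.

Lemma to_loc_unit u : u \notin P -> exists v, to_loc u * v = 1.
Proof.
move=> uP; exists (\pi_(localization P) (Localization.mk 1 uP)).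
rewrite /to_loc !piE; apply: Localization.eq_loc.
by rewrite !Localization.numE !Localization.denE; ring.
Qed.

Lemma to_loc_frac x : exists u n, u \notin P /\ x * to_loc u = to_loc n.
Proof.
exists (Localization.den (repr x)), (Localization.num (repr x)).
split; first exact: Localization.denP.
rewrite -{1}[x]reprK /to_loc !piE; apply: Localization.eq_loc.
by rewrite !Localization.numE !Localization.denE; ring.
Qed.

Lemma to_loc_eq0 g : to_loc g = 0 <-> exists2 u, u \notin P & u * g = 0.
Proof.
have -> : (0 : localization P) =
    \pi_(localization P) (Localization.zerof P) by rewrite piE.
split=> [/eqP/Localization.eq_locP[u uP]|[u uP ug]].
  rewrite !Localization.numE !Localization.denE !mulr1 mulr0 => ug.
  by exists u.
apply/eqP/Localization.eq_locP; exists u => //.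
by rewrite !Localization.numE !Localization.denE !mulr1 mulr0.
Qed.

End Fraction.

Lemma cohen_macaulay_localization (S : comNzRingType) (I : idealr S)
    (P : prime_idealr S) :
  {subset I <= P} -> cohen_macaulay {ideal_quot I} ->
  exists (T : comNzRingType) (theta : {rmorphism S -> T}),
    is_localization I P theta /\ local_cohen_macaulay T.
Proof.
move=> IP [_ cm]; have [Q QE] := quotient_prime IP.
exists (localization Q), (@to_loc _ Q \o \pi_{ideal_quot I}).
split; last exact: cm.
split=> [u uP|x|g] /=.
- by apply: to_loc_unit; rewrite QE.
- have [u [n [uQ xE]]] := to_loc_frac x; exists (repr u), (repr n).
  by rewrite /= !reprK -QE reprK.
- split=> [/to_loc_eq0[u uQ ug]|[u uP ug]].
    exists (repr u); first by rewrite -QE reprK.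
    rewrite -[_ * g]subr0 Quotient.idealrBE; apply/eqP.
    by rewrite rmorphM /= reprK ug; apply: esym; apply: rmorph0.
apply/to_loc_eq0; exists (\pi_{ideal_quot I} u); first by rewrite QE.
rewrite -rmorphM -(rmorph0 \pi_{ideal_quot I}); apply/eqP.
by rewrite -Quotient.idealrBE subr0.
Qed.

Section Theory.
Variables (S T : comNzRingType) (I : {pred S}) (P : prime_idealr S).
Variables (theta : {rmorphism S -> T}).
Hypothesis locT : is_localization I P theta.

Lemma loc_inj_unit u x y :
  u \notin P -> x * theta u = y * theta u -> x = y.
Proof.
move=> /(loc_unit locT)[v uv] /(congr1 ( *%R^~ v)).
by rewrite -!mulrA uv !mulr1.
Qed.

Lemma loc_eq0 u x : u \notin P -> theta u * x = 0 -> x = 0.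
Proof.
by move=> uP ux; apply: (loc_inj_unit uP); rewrite mulrC ux mul0r.
Qed.

Lemma loc_in g : g \in I -> theta g = 0.
Proof.
by move=> gI; apply/(loc_ker locT); exists 1; rewrite ?idealr1 // mul1r.
Qed.

(** The extension of [Q] consists of the fractions with numerator in [Q]. This does not depend on
    the fraction chosen: the kernel is controlled by [I], which lies in [Q], and denominators avoid
    [P], hence [Q]. *)
Lemma loc_prime (Q : prime_idealr S) :
  {subset I <= Q} -> {subset Q <= P} ->
  exists Q' : prime_idealr T, forall g, (theta g \in Q') = (g \in Q).
Proof.
move=> IQ QP.
have PQ u : u \notin P -> u \notin Q by apply: contra; apply: QP.
pose Q' : {pred T} := [pred x | `[< exists u n,
   [/\ u \notin P, x * theta u = theta n & n \in Q] >]].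
have Q'E x u n : u \notin P -> x * theta u = theta n ->
    (x \in Q') = (n \in Q).
  move=> uP xE; apply/asboolP/idP => [[v [k [vP xvE kQ]]]|nQ]; last first.
    by exists u, n.
  have /(loc_ker locT)[w wP] : theta (n * v - k * u) = 0.
    by rewrite rmorphB !rmorphM -xE -xvE; ring.
  move=> /IQ; rewrite prime_idealrM (negPf (PQ _ wP)) /= => nvQ.
  have : n * v \in Q by rewrite -(subrK (k * u) (n * v)) rpredD // mulrC idealMr.
  by rewrite prime_idealrM (negPf (PQ _ vP)) orbF.
have one_P : (1 : S) \notin P by rewrite idealr1.
have Q'theta g : (theta g \in Q') = (g \in Q).
  by apply: (Q'E _ 1) => //; rewrite rmorph1 mulr1.
have [|x y|Q1 Q1E] := @prime_idealr_of_closed _ Q'; last first.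
- by exists Q1 => g; rewrite Q1E.
- have [u [n [uP xE]]] := loc_frac locT x.
  have [v [k [vP yE]]] := loc_frac locT y.
  rewrite (Q'E _ _ _ uP xE) (Q'E _ _ _ vP yE) -prime_idealrM.
  rewrite (Q'E _ (u * v) (n * k)) //.
    by rewrite prime_idealrM (negPf uP).
  by rewrite !rmorphM -xE -yE; ring.
split=> [||a x y].
- by rewrite -(rmorph0 theta) Q'theta rpred0.
- by rewrite -(rmorph1 theta) Q'theta idealr1.
have [w [l [wP aE]]] := loc_frac locT a.
have [u [n [uP xE]]] := loc_frac locT x.
have [v [k [vP yE]]] := loc_frac locT y.
rewrite (Q'E _ _ _ uP xE) (Q'E _ _ _ vP yE) => nQ kQ.
rewrite (Q'E _ (w * u * v) (l * n * v + k * w * u)).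
- by rewrite rpredD //; [rewrite mulrAC idealMr | rewrite -mulrA mulrC idealMr].
- by rewrite !prime_idealrM (negPf wP) (negPf uP).
- by rewrite rmorphD !rmorphM -aE -xE -yE; ring.
Qed.

Lemma loc_nonunit f : nonunit f ->
  exists u n, [/\ u \notin P, n \in P & f * theta u = theta n].
Proof.
move=> fN; have [u [n [uP fE]]] := loc_frac locT f; exists u, n; split=> //.
apply/negPn/negP => /(loc_unit locT)[v nv]; apply: fN.
by exists (theta u * v); rewrite mulrA fE.
Qed.

Lemma loc_dim_ge2 (Q0 Q1 : prime_idealr S) d :
  {subset I <= Q0} -> {subset Q0 <= Q1} -> {subset Q1 <= P} ->
  (exists2 x, x \in Q1 & x \notin Q0) -> (exists2 x, x \in P & x \notin Q1) ->
  krull_dim T d -> (2 <= d)%N.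
Proof.
move=> IQ0 Q01 Q1P [x xQ1 xQ0] [y yP yQ1] [_ maxd].
have IQ1 : {subset I <= Q1} by move=> ? /IQ0/Q01.
have IP : {subset I <= P} by move=> ? /IQ1/Q1P.
have Q0P : {subset Q0 <= P} by move=> ? /Q01/Q1P.
have [q0 q0E] := loc_prime IQ0 Q0P.
have [q1 q1E] := loc_prime IQ1 Q1P.
have [q2 q2E] := loc_prime IP (fun _ h => h).
have sub (Q Q' : prime_idealr S) (q q' : prime_idealr T) :
    (forall g, (theta g \in q) = (g \in Q)) ->
    (forall g, (theta g \in q') = (g \in Q')) ->
    {subset Q <= Q'} -> {subset Q' <= P} -> {subset q <= q'}.
  move=> qE q'E QQ' Q'P z zq.
  have [u [n [uP zE]]] := loc_frac locT z.
  have : z * theta u \in q' by rewrite zE q'E QQ' // -qE -zE mulrC idealMr.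
  rewrite prime_idealrM q'E => /orP[//|/Q'P].
  by rewrite (negPf uP).
apply: (maxd 2 (fun i => if i is i'.+1 then (if i' is 0 then q1 else q2) else q0)).
move=> [|[|]] //= _; split.
- exact: sub Q01 Q1P.
- by exists (theta x); rewrite ?q1E ?q0E.
- exact: sub Q1P _.
- by exists (theta y); rewrite ?q2E ?q1E.
Qed.

End Theory.

(** The first two terms of a regular sequence of length [d], with membership in the ideals generated
    by no element and by [f1] made explicit. *)
Lemma depth_ge2_regular (T : comNzRingType) d :
  local_depth T d -> (2 <= d)%N ->
  exists f1 f2 : T, [/\ nonunit f1, nonunit f2,
    forall a, a * f1 = 0 -> a = 0 &
    forall a b, a * f2 = b * f1 -> exists c, a = c * f1].
Proof.
move=> [[q [[_ qreg] qN] <-] _]; case: q qreg qN => [|f1 [|f2 q]] //= qreg qN _.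
exists f1, f2; split.
- by apply: qN; rewrite !inE eqxx.
- by apply: qN; rewrite !inE eqxx orbT.
- move=> a af; have /(_ _) /asboolP[] := qreg 0%N isT a.
    by apply/asboolP; exists [::]; rewrite ?big_nil.
  by move=> t tP ->; rewrite big_seq big1 // => cg /tP; rewrite inE.
move=> a b E; have /(_ _) /asboolP[] := qreg 1%N isT a.
  apply/asboolP; exists [:: (b, f1)]; last by rewrite big_seq1.
  by move=> cg; rewrite !inE => /eqP->.
move=> t tP ->; exists (\sum_(cg <- t) cg.1).
rewrite mulr_suml; apply: eq_big_seq => cg /tP.
by rewrite !inE ?take0 => /eqP->.
Qed.

End Localizations.

(** * Membership in monomial primes and in their intersections *)

Section VariableIdealLemmas.
Variables (K : fieldType) (s : nat).
Local Notation S := {mpoly K[s]}.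
Implicit Types (AA BB : {set {set 'I_s}}) (C D F : {set 'I_s}) (f g : S) (m : 'X_{1..s}).

(** Each monomial occurring in [f] has positive degree in [C], so some variable of [C] can be split
    off. *)
Lemma var_ideal_ind C (Q : S -> Prop) :
  Q 0 -> (forall f g, Q f -> Q g -> Q (f + g)) ->
  (forall k f, k \in C -> Q (f * 'X_k)) ->
  forall f, f \in var_ideal K C -> Q f.
Proof.
move=> Q0 QD QM f /var_idealP fC; rewrite [f]mpolyE.
elim/big_ind: _ => // m _.
have [/fC->|] := eqVneq (deg_in C m) 0%N; first by rewrite scale0r.
rewrite /deg_in sum_nat_eq0 => /forallPn[k]; rewrite negb_imply -lt0n.
move=> /andP[kC mk]; have -> : m = (m - U_(k) + U_(k))%MM.
  by rewrite submK //; apply/mnm_lepP => i; rewrite mnm1E; case: eqP => // <-.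
by rewrite mpolyXD scalerAl; apply: QM.
Qed.

Lemma var_ideal_subset C (p : idealr S) :
  (forall k, k \in C -> 'X_k \in p) -> {subset var_ideal K C <= p}.
Proof.
move=> Cp; apply: var_ideal_ind => [|f g|k f /Cp]; first exact: rpred0.
  exact: rpredD.
exact: idealMr.
Qed.

Definition set_monomial D : S := \prod_(k in D) 'X_k.

Lemma mem_set_monomial D F :
  (set_monomial D \in var_ideal K (~: F)) = ~~ (D \subset F).
Proof.
apply/idP/idP => [|/subsetPn[k kD kF]]; last first.
  rewrite /set_monomial (bigD1 k) //= mulrC; apply: idealMr.
  by rewrite mem_var_ideal inE.
apply: contraL => /subsetP DF; rewrite /set_monomial.
elim/big_ind: _ => [|f g fF gF|k /DF kF]; first by rewrite idealr1.
  by rewrite prime_idealrM negb_or fF.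
by rewrite mem_var_ideal inE kF.
Qed.

(** The Stanley--Reisner ideal of the simplicial complex generated by [AA]. *)
Definition face_ideal (AA : {set {set 'I_s}}) : {pred S} :=
  [pred f | [forall F in AA, f \in var_ideal K (~: F)]].

Lemma face_idealP AA f :
  reflect (forall F, F \in AA -> f \in var_ideal K (~: F)) (f \in face_ideal AA).
Proof. exact: forall_inP. Qed.

Lemma face_idealM AA f g : g \in face_ideal AA -> f * g \in face_ideal AA.
Proof. by move=> /face_idealP h; apply/face_idealP => F /h /idealMr. Qed.

Lemma face_ideal0 AA : 0 \in face_ideal AA.
Proof. by apply/face_idealP => F _; apply: rpred0. Qed.

Lemma face_idealD AA f g :
  f \in face_ideal AA -> g \in face_ideal AA -> f + g \in face_ideal AA.
Proof.
move=> /face_idealP h /face_idealP k; apply/face_idealP => F FA.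
by rewrite rpredD ?h ?k.
Qed.

(** Since [set_monomial D] becomes a unit at the prime of [~: D], this says that the two face ideals
    locally add up to the maximal ideal. For a variable ['X_k] the product is
    [set_monomial (k |: D)], which lies in one of them by hypothesis. *)
Lemma face_ideal_split (AA BB : {set {set 'I_s}}) D n :
  (forall k, k \notin D ->
     (forall F, F \in AA -> ~~ (k |: D \subset F)) \/
     (forall F, F \in BB -> ~~ (k |: D \subset F))) ->
  n \in var_ideal K (~: D) ->
  exists a b, [/\ a \in face_ideal AA, b \in face_ideal BB &
                  n * set_monomial D = a + b].
Proof.
move=> DP; apply: (@var_ideal_ind _ (fun n => exists a b,
  [/\ a \in face_ideal AA, b \in face_ideal BB & n * set_monomial D = a + b])).
- by exists 0, 0; rewrite !face_ideal0 mul0r addr0.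
- move=> f g [a [b [aA bB fE]]] [a' [b' [aA' bB' gE]]].
  exists (a + a'), (b + b'); split; try exact: face_idealD.
  by rewrite mulrDl fE gE addrACA.
move=> k f; rewrite inE => kD.
have kE : 'X_k * set_monomial D = set_monomial (k |: D).
  by rewrite /set_monomial big_setU1.
rewrite -mulrA kE; have [h|h] := DP k kD.
  exists (f * set_monomial (k |: D)), 0; split; rewrite ?face_ideal0 ?addr0 //.
  by apply/face_idealM/face_idealP => F /h; rewrite mem_set_monomial.
exists 0, (f * set_monomial (k |: D)); split; rewrite ?face_ideal0 ?add0r //.
by apply/face_idealM/face_idealP => F /h; rewrite mem_set_monomial.
Qed.

End VariableIdealLemmas.

Arguments face_ideal K {s} AA.
Arguments set_monomial K {s} D.

(** * Edge ideals, their symbolic squares, and the local argument *)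

Section EdgeIdeals.
Variables (K : fieldType) (s : nat) (e : rel 'I_s).
Hypotheses (e_sym : ssrbool.symmetric e) (e_irr : irreflexive e).
Local Notation S := {mpoly K[s]}.
Local Notation J := (symbolic_power (edge_ideal K e) 2).
Implicit Types (F G : {set 'I_s}) (AA BB : {set {set 'I_s}}) (f g : S).

Lemma stableP F :
  reflect (forall a b, a \in F -> b \in F -> ~~ e a b) (stable e F).
Proof.
apply: (iffP forall_inP) => [h a b aF bF|h a aF].
  by have /forall_inP := h a aF; apply.
by apply/forall_inP => b; apply: h.
Qed.

Lemma edge_ideal_gen a b : e a b -> 'X_a * 'X_b \in edge_ideal K e.
Proof.
move=> eab; apply/asboolP; exists [:: (1, 'X_a * 'X_b)].
  move=> cg; rewrite inE => /eqP->; rewrite inE.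
  by apply/existsP; exists a; apply/existsP; exists b; rewrite eab eqxx.
by rewrite big_seq1 mul1r.
Qed.

Lemma edge_idealMl f g : g \in edge_ideal K e -> f * g \in edge_ideal K e.
Proof.
move=> /asboolP[t tP ->]; apply/asboolP.
exists [seq (f * cg.1, cg.2) | cg <- t].
  by move=> ? /mapP[cg /tP cgP ->].
by rewrite big_map mulr_sumr; apply: eq_bigr => cg _; rewrite mulrA.
Qed.

Lemma edge_idealD f g :
  f \in edge_ideal K e -> g \in edge_ideal K e -> f + g \in edge_ideal K e.
Proof.
move=> /asboolP[t tP ->] /asboolP[u uP ->]; apply/asboolP.
exists (t ++ u); last by rewrite big_cat.
by move=> cg; rewrite mem_cat => /orP[/tP|/uP].
Qed.

Lemma edge_ideal0 : 0 \in edge_ideal K e.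
Proof. by apply/asboolP; exists [::]; rewrite ?big_nil. Qed.

Lemma edge_ideal_stable F :
  stable e F -> {subset edge_ideal K e <= var_ideal K (~: F)}.
Proof.
move=> /stableP Fst f /asboolP[t tP ->]; rewrite big_seq.
apply: rpred_sum => cg /tP; rewrite inE => /existsP[a /existsP[b]].
move=> /andP[eab /eqP->]; apply: idealMr.
rewrite prime_idealrM !mem_var_ideal !inE -negb_and.
by apply: contraL eab => /andP[aF bF]; apply: Fst.
Qed.

Lemma maxstable_neighbor F k :
  maxset (stable e) F -> k \notin F -> exists2 l, l \in F & e k l.
Proof.
move=> /maxsetP[/stableP Fst Fmax] kF; apply/exists_inP.
apply: contraNT kF; rewrite negb_exists_in => /forall_inP kN.
have <- : k |: F = F; last by rewrite setU11.
apply: Fmax; last exact: subsetUr.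
apply/stableP => a b /setU1P[->|aF] /setU1P[->|bF].
- by rewrite e_irr.
- exact: kN.
- by rewrite e_sym kN.
- exact: Fst.
Qed.

(** The prime is the annihilator of [set_monomial F]: by maximality every [k] outside [F] has a
    neighbor in [F], so ['X_k] times this monomial is divisible by an edge. *)
Lemma maxstable_associated F : maxset (stable e) F ->
  associated_prime (edge_ideal K e) (var_ideal K (~: F)).
Proof.
move=> Fmax; have /maxsetp Fst := Fmax; exists (set_monomial K F) => a.
apply/idP/idP => [|/(edge_ideal_stable Fst)]; last first.
  by rewrite prime_idealrM mem_set_monomial subxx orbF.
move: a; apply: var_ideal_ind => [|f g|k f].
- by rewrite mul0r edge_ideal0.
- by rewrite mulrDl; apply: edge_idealD.
rewrite inE => kF; rewrite -mulrA; apply: edge_idealMl.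
have [l lF ekl] := maxstable_neighbor Fmax kF.
rewrite /set_monomial (bigD1 l) //= mulrA [_ * \prod_(_ | _) _]mulrC.
exact/edge_idealMl/edge_ideal_gen.
Qed.

Lemma symbolic_square_var_ideal2 F :
  maxset (stable e) F -> {subset J <= var_ideal2 K (~: F)}.
Proof.
move=> Fmax f /asboolP h; apply: var_ideal_exp2.
by apply: h; apply: maxstable_associated.
Qed.

Lemma associated_prime_subset (p : prime_idealr S) :
  associated_prime (edge_ideal K e) p -> {subset edge_ideal K e <= p}.
Proof. by move=> [f pE] a aI; rewrite pE mulrC; apply: edge_idealMl. Qed.

(** Let [p] be an associated prime. If it contains both ['X_i] and ['X_j], their product is in its
    square. If it misses ['X_i], say, it contains ['X_j]; the vertices whose variables it misses
    form a stable set, and a maximal stable [F] around it contains [i] and satisfies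
    [var_ideal (~: F)] inside [p]. So [g] is in [p] as well. *)
Lemma edge_mul_symbolic_square i j g : e i j ->
  (forall F, maxset (stable e) F -> (i \in F) || (j \in F) ->
     g \in var_ideal K (~: F)) ->
  'X_i * 'X_j * g \in J.
Proof.
move=> eij gP; apply/asboolP => p /associated_prime_subset Ip.
have exp2 x y z : x \in p -> y \in p -> z * (x * y) \in ideal_exp p 2.
  move=> xp yp; apply/asboolP; exists [:: (z, x * y)]; last by rewrite big_seq1.
  move=> cg; rewrite inE => /eqP->; apply/asboolP; exists [tuple x; y].
    by move=> ? /[!inE] /orP[] /eqP->.
  by rewrite !big_cons big_nil mulr1.
have one k l : e k l -> 'X_k \notin p -> (k \in [:: i; j]) -> g \in p /\ 'X_l \in p.
  move=> ekl kp kij.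
  have lp : 'X_l \in p.
    by have := Ip _ (edge_ideal_gen ekl); rewrite prime_idealrM (negPf kp).
  split=> //; pose C := [set k | 'X_k \in p].
  have Cst : stable e (~: C).
    apply/stableP => a b; rewrite !inE => ap bp; apply/negP => /edge_ideal_gen/Ip.
    by rewrite prime_idealrM (negPf ap) (negPf bp).
  have [F Fmax CF] := maxset_exists Cst.
  apply: (@var_ideal_subset _ _ (~: F) p).
    by move=> a; rewrite inE; apply: contraNT => ap; apply: (subsetP CF); rewrite !inE.
  apply: gP => //; have kF : k \in F by apply: (subsetP CF); rewrite !inE.
  by move: kij; rewrite !inE => /orP[] /eqP<-; rewrite kF ?orbT.
have [ip|ip] := boolP ('X_i \in p); last first.
  have [|gp jp] := one i j eij ip; first by rewrite !inE eqxx.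
  by rewrite -mulrA; apply: exp2.
have [jp|jp] := boolP ('X_j \in p); first by rewrite mulrC; apply: exp2.
have [||gp _] := one j i _ jp; rewrite ?inE ?eqxx ?orbT // 1?e_sym //.
by rewrite ['X_i * _]mulrC -mulrA; apply: exp2.
Qed.

Definition edge_star i j : {set {set 'I_s}} :=
  [set F | maxset (stable e) F & (i \in F) || (j \in F)].

Lemma edge_star_xor i j F : e i j -> F \in edge_star i j ->
  ((i \in ~: F) + (j \in ~: F) = 1)%N.
Proof.
move=> eij; rewrite inE => /andP[/maxsetp/stableP Fst]; rewrite !inE.
by case iF : (i \in F); case jF : (j \in F) => //; have := Fst _ _ iF jF; rewrite eij.
Qed.

(** Only one of the two differences is bounded; exchanging the families gives the other. *)
Lemma edge_star_codim1 i j AA BB F F' :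
  cohen_macaulay_ideal J -> e i j ->
  AA :|: BB = edge_star i j -> [disjoint AA & BB] -> F \in AA -> F' \in BB ->
  (forall G G', G \in AA -> G' \in BB -> (#|G :&: G'| <= #|F :&: F'|)%N) ->
  (#|F :\: F'| <= 1)%N.
Proof.
move=> [I IJ cm] eij ABE ABdis FA FB Dmax; rewrite leqNgt; apply/negP.
move=> /card_gt1P[k1 [k2 [/setDP[k1F k1F'] /setDP[k2F k2F'] k12]]].
set D := F :&: F'.
have AS G : G \in AA -> G \in edge_star i j by rewrite -ABE inE => ->.
have BS G : G \in BB -> G \in edge_star i j by rewrite -ABE inE orbC => ->.
have starmax G : G \in edge_star i j -> maxset (stable e) G.
  by rewrite inE => /andP[].
have Fmax := starmax _ (AS _ FA); have F'max := starmax _ (BS _ FB).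
have IF2 G : maxset (stable e) G -> {subset I <= var_ideal2 K (~: G)}.
  by move=> Gmax f; rewrite IJ; apply: symbolic_square_var_ideal2.
have IF : {subset I <= var_ideal K (~: F)}.
  by move=> f /(IF2 _ Fmax) /andP[].
pose P : prime_idealr S := var_ideal K (~: D).
pose Q0 : prime_idealr S := var_ideal K (~: F).
(* The chain [Q0], [Q1], [P] is strict because of ['X_k1] and ['X_k2], so the local ring has
   dimension at least 2. *)
pose Q1 : prime_idealr S := var_ideal K (k1 |: ~: F).
have DF : ~: F \subset ~: D by rewrite setCS subsetIl.
have DF' : ~: F' \subset ~: D by rewrite setCS subsetIr.
have Q01 : {subset Q0 <= Q1} by apply: var_idealS; apply: subsetUr.
have Q1P : {subset Q1 <= P}.
  by apply: var_idealS; rewrite subUset DF sub1set !inE negb_and k1F' orbT.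
have IP : {subset I <= P} by move=> f /IF/Q01/Q1P.
have [T [theta [locT [d depth_d dim_d]]]] := cohen_macaulay_localization IP cm.
have d2 : (2 <= d)%N.
  apply: (loc_dim_ge2 locT IF Q01 Q1P _ _ dim_d).
    by exists 'X_k1; rewrite mem_var_ideal !inE ?eqxx ?k1F.
  exists 'X_k2; rewrite mem_var_ideal !inE ?negb_and ?k2F' ?orbT //.
  by rewrite eq_sym (negPf k12) k2F.
have [f1 [f2 [f1N f2N reg1 reg2]]] := depth_ge2_regular depth_d d2.
pose v := set_monomial K D.
have vP : v \notin P by rewrite mem_set_monomial negbK.
(* If [k |: D] were contained in a member of each family, these would meet in more than [D], against
   the choice of [F] and [F']. *)
have split_f (f : T) : nonunit f -> exists u a b, [/\ u \notin P,
    a \in face_ideal K AA, b \in face_ideal K BB & f * theta u = theta (a + b)].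
  move=> /(loc_nonunit locT)[u [n [uP nP fE]]].
  have [|a [b [aA bB abE]]] := @face_ideal_split K s AA BB D n _ nP.
    move=> k kD.
    have [/forall_inP|/forall_inPn[G GA]] := boolP
      [forall F in AA, ~~ (k |: D \subset F)]; first by left.
    rewrite negbK => kDG; right => G' GB; apply/negP => kDG'.
    have := Dmax _ _ GA GB; rewrite leqNgt => /negP; apply.
    apply: (@leq_trans #|k |: D|); first by rewrite cardsU1 kD.
    by apply: subset_leq_card; rewrite subsetI kDG.
  exists (u * v), a, b; split=> //; first by rewrite prime_idealrM negb_or uP.
  by rewrite rmorphM mulrA fE -rmorphM abE.
have [u1 [a1 [b1 [u1P a1A b1B f1E]]]] := split_f f1 f1N.
have [u2 [a2 [b2 [u2P a2A b2B f2E]]]] := split_f f2 f2N.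
pose w : S := 'X_i * 'X_j.
have wab a b : a \in face_ideal K AA -> b \in face_ideal K BB ->
    theta (w * (a * b)) = 0.
  move=> aA bB; apply: (loc_in locT); rewrite IJ.
  apply: edge_mul_symbolic_square => // G Gmax Gij.
  have : G \in AA :|: BB by rewrite ABE inE Gmax.
  rewrite prime_idealrM => /setUP[GA|GB]; apply/orP; [left|right].
    by apply/face_idealP: GA.
  by apply/face_idealP: GB.
(* With denominators cleared, both sides of the required equation are the image of [w * a1 * a2]:
   the cross terms vanish by [wab]. *)
have [c' c'E] : exists c, theta (w * a1 * u2) = c * f1.
  apply: (reg2 _ (theta (w * a2 * u1))).
  transitivity (theta (w * a1) * (f2 * theta u2)); first by rewrite rmorphM; ring.
  transitivity (theta (w * a2) * (f1 * theta u1)); last by rewrite rmorphM; ring.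
  rewrite f1E f2E -!rmorphM.
  have -> : w * a1 * (a2 + b2) = w * (a1 * a2) + w * (a1 * b2) by ring.
  have -> : w * a2 * (a1 + b1) = w * (a1 * a2) + w * (a2 * b1) by ring.
  by rewrite !rmorphD (wab _ _ a1A b2B) (wab _ _ a2A b1B).
have [t' [c [t'P cE]]] := loc_frac locT c'.
(* All denominators are gathered in [t], so that the relations below are between images of
   polynomials, with [t * w] in place of [w]. *)
pose t := u1 * u2 * t'.
have tP : t \notin P by rewrite !prime_idealrM !negb_or u1P u2P.
have tE : theta (t * w * a1) = theta (c * (a1 + b1)).
  rewrite [in RHS]rmorphM -cE -f1E.
  transitivity (theta (w * a1 * u2) * (theta u1 * theta t')).
    by rewrite -!rmorphM; congr (theta _); rewrite /t; ring.
  by rewrite c'E; ring.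
have reg1' x : theta ((a1 + b1) * x) = 0 -> theta x = 0.
  rewrite rmorphM -f1E => h; apply: (loc_eq0 locT u1P); apply: reg1.
  by rewrite -h; ring.
have colonA a : a \in face_ideal K AA -> theta ((t * w - c) * a) = 0.
  move=> aA; apply: reg1'.
  have -> : (a1 + b1) * ((t * w - c) * a) =
     t * (w * (a * b1)) + t * w * a1 * a - c * (a1 + b1) * a by ring.
  by rewrite rmorphB rmorphD [theta (t * _)]rmorphM wab // mulr0 add0r
     !(rmorphM _ _ a) tE subrr.
have colonB b : b \in face_ideal K BB -> theta (c * b) = 0.
  move=> bB; apply: reg1'.
  have -> : (a1 + b1) * (c * b) = c * (a1 + b1) * b by ring.
  rewrite rmorphM -tE -rmorphM.
  have -> : t * w * a1 * b = t * (w * (a1 * b)) by ring.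
  by rewrite rmorphM wab // mulr0.
(* By maximality [G] lies in no member of [CC], so [set_monomial G] is in the face ideal; it is
   outside the prime of [~: G] and can be cancelled by primarity. *)
have colon_var (CC : {set {set 'I_s}}) G x : maxset (stable e) G ->
    ~: G \subset ~: D -> {subset CC <= edge_star i j} -> G \notin CC ->
    (forall a, a \in face_ideal K CC -> theta (x * a) = 0) ->
    x \in var_ideal2 K (~: G).
  move=> Gmax GD CS GC xC.
  have /xC/(loc_ker locT)[u uP] : set_monomial K G \in face_ideal K CC.
    apply/face_idealP => H HC; rewrite mem_set_monomial.
    apply: contra GC => GH; have [_ /(_ H) <-//] := maxsetP Gmax.
    by have /maxsetp := starmax _ (CS _ HC).
  move=> /(IF2 _ Gmax).
  have -> : u * (x * set_monomial K G) = u * set_monomial K G * x by ring.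
  apply: var_ideal2_primary; rewrite prime_idealrM negb_or mem_set_monomial.
  by rewrite subxx andbT; apply: contra uP; apply: var_idealS.
have FnB : F \notin BB by rewrite (disjointFr ABdis).
have F'nA : F' \notin AA by rewrite (disjointFl ABdis).
have cF := colon_var BB F c Fmax DF BS FnB colonB.
have cF' := colon_var AA F' _ F'max DF' AS F'nA colonA.
(* As [t] is outside [P], it has a monomial [m] in the variables of [D] alone. At [M], the product
   of [m] and [w], the coefficients of [c] and [t * w - c] vanish, while that of [t * w] is
   [t@_m]. *)
have [m mD tm] : exists2 m, deg_in (~: D) m = 0%N & t@_m != 0.
  apply: contrapT => h; move/negP: tP; apply; apply/var_idealP => m mD.
  by apply/eqP/negPn/negP => tm; apply: h; exists m.
pose M := (U_(i) + U_(j) + m)%MM.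
have degM G : ~: G \subset ~: D -> G \in edge_star i j -> deg_in (~: G) M = 1%N.
  move=> GD GS; rewrite /M !deg_inD !deg_in1 edge_star_xor // add1n.
  by congr _.+1; apply/eqP; rewrite -leqn0 -mD deg_inS.
have := mcoeff_var_ideal2 cF' (degM _ DF' (BS _ FB)).
rewrite mcoeffB (mcoeff_var_ideal2 cF (degM _ DF (AS _ FA))) subr0.
by rewrite /w /M -mpolyXD mcoeffMX; apply/eqP.
Qed.

End EdgeIdeals.

(** * Connectedness and cardinality of the maximal stable sets meeting an edge *)

Section EdgeCritical.
Variables (K : fieldType) (s : nat) (e : rel 'I_s).
Hypotheses (e_sym : ssrbool.symmetric e) (e_irr : irreflexive e).
Hypothesis cmJ : cohen_macaulay_ideal (symbolic_power (edge_ideal K e) 2).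
Implicit Types (F : {set 'I_s}) (AA BB : {set {set 'I_s}}).

Lemma edge_star_connected i j AA BB : e i j ->
  AA :|: BB = edge_star e i j -> [disjoint AA & BB] ->
  AA != set0 -> BB != set0 ->
  exists F F', [/\ F \in AA, F' \in BB,
    #|F| = #|F :&: F'|.+1 & #|F'| = #|F :&: F'|.+1].
Proof.
move=> eij ABE ABdis /set0Pn[F0 F0A] /set0Pn[G0 G0B].
have FG0 : (F0, G0) \in setX AA BB by apply/setXP.
case: (arg_maxnP (fun p : {set 'I_s} * {set 'I_s} => #|p.1 :&: p.2|) FG0).
move=> [F F'] /setXP[/= FA FB] Dmax; exists F, F'.
have FmaxE G : G \in AA :|: BB -> maxset (stable e) G.
  by rewrite ABE inE => /andP[].
have Fmax : maxset (stable e) F by apply: FmaxE; rewrite inE FA.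
have F'max : maxset (stable e) F' by apply: FmaxE; rewrite inE FB orbT.
have FF' : F != F'.
  by apply: contraTneq FB => <-; rewrite (disjointFr ABdis).
(* Distinct maximal stable sets are incomparable, which turns the bounds [<= 1] into equalities. *)
have diff_gt0 G H : maxset (stable e) G -> maxset (stable e) H -> G != H ->
    (0 < #|G :\: H|)%N.
  move=> /maxsetP[_ Gmax] /maxsetp Hst GH; rewrite card_gt0 setD_eq0.
  by apply: contra GH => /(Gmax _ Hst)->.
have maxI G H : G \in AA -> H \in BB -> (#|G :&: H| <= #|F :&: F'|)%N.
  by move=> GA HB; apply: (Dmax (G, H)); apply/setXP.
have leF : (#|F :\: F'| <= 1)%N.
  exact: (edge_star_codim1 e_sym e_irr cmJ eij ABE ABdis FA FB).
have leF' : (#|F' :\: F| <= 1)%N.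
  apply: (edge_star_codim1 e_sym e_irr cmJ eij _ _ FB FA).
  - by rewrite setUC.
  - by rewrite disjoint_sym.
  - by move=> G H GB HA; rewrite [G :&: H]setIC [F' :&: F]setIC; apply: maxI.
have eqF : #|F :\: F'| = 1%N.
  by apply/eqP; rewrite eqn_leq leF diff_gt0.
have eqF' : #|F' :\: F| = 1%N.
  by apply/eqP; rewrite eqn_leq leF' diff_gt0 // eq_sym.
split=> //; first by rewrite -(cardsID F' F) eqF addn1.
by rewrite -(cardsID F F') eqF' addn1 setIC.
Qed.

Lemma edge_star_pure i j F F' : e i j ->
  F \in edge_star e i j -> F' \in edge_star e i j -> #|F| = #|F'|.
Proof.
move=> eij FS F'S; apply/eqP/negPn/negP => FF'.
pose AA := [set G in edge_star e i j | #|G| == #|F|].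
pose BB := [set G in edge_star e i j | #|G| != #|F|].
have [||||G [H [GA HB GE HE]]] := @edge_star_connected i j AA BB eij.
- by apply/setP => G; rewrite !inE -andb_orr orbN andbT.
- rewrite -setI_eq0; apply/eqP/setP => G; rewrite !inE.
  by case: (_ == _); rewrite !andbF.
- by apply/set0Pn; exists F; apply/setIdP.
- by apply/set0Pn; exists F'; apply/setIdP; rewrite eq_sym.
case/setIdP: GA => _ /eqP GF; case/setIdP: HB => _.
by rewrite HE -GE GF eqxx.
Qed.

(** A maximum stable set [F2] meeting the edge has the size of [F] by purity. Otherwise the end of
    the edge lying in [F] has a neighbor [l] in [F2], and purity applies to the edge joining that
    end to [l], whose star contains both sets. *)
Lemma edge_star_card i j F : e i j -> F \in edge_star e i j ->
  #|F| = independence_number e.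
Proof.
move=> eij FS.
have [F2 F2st F2E] : exists2 F2, stable e F2 & independence_number e = #|F2|.
  have [|F2] := @eq_bigmax_cond _ (stable e) (fun A : {set 'I_s} => #|A|).
    by apply/card_gt0P; exists set0; apply/stableP => a b; rewrite inE.
  by exists F2.
have F2max : maxset (stable e) F2.
  apply/maxsetP; split=> // G Gst F2G; apply/esym/eqP; rewrite eqEcard F2G -F2E.
  by rewrite /independence_number leq_bigmax_cond.
rewrite F2E.
have [iF2|iF2] := boolP (i \in F2).
  by apply: (edge_star_pure eij) => //; rewrite inE F2max iF2.
have [jF2|jF2] := boolP (j \in F2).
  by apply: (edge_star_pure eij) => //; rewrite inE F2max jF2 orbT.
move: (FS); rewrite inE => /andP[Fmax /orP[iF|jF]].
  have [l lF2 eil] := maxstable_neighbor e_sym e_irr F2max iF2.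
  by apply: (edge_star_pure eil); rewrite inE ?F2max ?Fmax ?iF ?lF2 ?orbT.
have [l lF2 ejl] := maxstable_neighbor e_sym e_irr F2max jF2.
by apply: (edge_star_pure ejl); rewrite inE ?F2max ?Fmax ?jF ?lF2 ?orbT.
Qed.

End EdgeCritical.

Theorem theorem4p8 (K : fieldType) (s : nat) (e : rel 'I_s)
    (e_sym : ssrbool.symmetric e) (e_irr : irreflexive e) :
  cohen_macaulay_ideal (symbolic_power (edge_ideal K e) 2) ->
  edge_critical e.
Proof.
move=> cmJ i j eij.
pose AA := [set F in edge_star e i j | i \in F].
pose BB := [set F in edge_star e i j | j \in F].
have max1 k : exists2 F, maxset (stable e) F & k \in F.
  have : stable e [set k].
    by apply/stableP => a b /set1P-> /set1P->; rewrite e_irr.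
  by move=> /maxset_exists[F Fmax]; rewrite sub1set; exists F.
have notboth F : maxset (stable e) F -> i \in F -> j \notin F.
  by move=> /maxsetp/stableP Fst iF; apply: contraL eij; apply: Fst.
have [||||F [F' [FA FB FE F'E]]] := edge_star_connected e_sym e_irr cmJ eij
  (AA := AA) (BB := BB).
- by apply/setP => F; rewrite !inE; case: (maxset _ _); case: (i \in F);
    case: (j \in F).
- rewrite -setI_eq0; apply/eqP/setP => F; rewrite !inE; apply/negP.
  by move=> /andP[/andP[/andP[Fmax _] iF] /andP[_ jF]];
    have := notboth F Fmax iF; rewrite jF.
- by have [F Fmax iF] := max1 i; apply/set0Pn; exists F; rewrite !inE Fmax iF.
- by have [F Fmax jF] := max1 j; apply/set0Pn; exists F; rewrite !inE Fmax jF orbT.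
have := FA; rewrite inE => /andP[FS iF]; have := FB; rewrite inE => /andP[F'S jF'].
have cardF := edge_star_card e_sym e_irr cmJ eij FS.
have Fmax : maxset (stable e) F by move: FS; rewrite inE => /andP[].
have F'max : maxset (stable e) F' by move: F'S; rewrite inE => /andP[].
have jF := notboth F Fmax iF.
have iF' : i \notin F' by apply: contraL jF'; apply: notboth.
set D := F :&: F' in FE F'E.
have FD : F = i |: D.
  apply/esym/eqP; rewrite eqEcard subUset sub1set iF subsetIl /= FE cardsU1.
  by rewrite !inE (negPf iF') andbF.
have FD' : F' = j |: D.
  apply/esym/eqP; rewrite eqEcard subUset sub1set jF' subsetIr /= F'E cardsU1.
  by rewrite !inE (negPf jF).
(* Apart from [i], the elements of [F] lie in [D], hence in the stable set [F'] together with [j];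
   the deleted edge was the only obstruction. *)
have st : stable (del_edge e i j) (j |: F).
  have /maxsetp/stableP Fst := Fmax; have /maxsetp/stableP F'st := F'max.
  apply/stableP => a b /setU1P[->|aF] /setU1P[->|bF] /=; rewrite negb_and negbK.
  - by rewrite e_irr.
  - move: bF; rewrite {1}FD => /setU1P[->|bD]; first by rewrite setUC eqxx orbT.
    by rewrite F'st // FD' setU1r.
  - move: aF; rewrite {1}FD => /setU1P[->|aD]; first by rewrite eqxx orbT.
    by rewrite F'st // FD' setU1r.
  - by rewrite Fst.
rewrite /critical -cardF.
have <- : #|j |: F| = #|F|.+1 by rewrite cardsU1 jF.
exact: leq_bigmax_cond.
Qed.
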